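(* Let $C = \{c_1 < c_2 < \cdots\}$ be an infinite set of natural numbers and let $\overline{C} = \mathbb{N} \setminus C = \{\overline{c_1} < \overline{c_2} < \cdots\}$. (i) If $\limsup_{i \to \infty} (c_{i+1} - c_i) = \infty$, then $C$ arises as a minimal additive complement in $\mathbb{Z}$. (ii) If $\overline{C}$ is infinite and $\lim_{i \to \infty} (\overline{c_{i+1}} - \overline{c_i}) = \infty$, then $C$ does not arise as a minimal additive complement in $\mathbb{Z}$.
   Context: $\mathbb{N}=\{1,2,3,\dots\}$. For subsets $C, W$ of an abelian group $G$, $C+W=\{c+w : c\in C, w\in W\}$. $C$ is an additive complement to $W$ if $C+W=G$; it is a minimal additive complement to $W$ if moreover $C'+W\neq G$ for every proper subset $C'\subsetneq C$. A set $C\subseteq G$ arises as a minimal additive complement in $G$ if there exists $W\subseteq G$ such that $C$ is a minimal additive complement to $W$. Here $G=\mathbb{Z}$. *)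

(* Defs.v *)
From HB Require Import structures.
From mathcomp Require Import all_boot all_order all_algebra.
From mathcomp Require Import all_classical all_reals all_analysis.
Set Implicit Arguments.
Unset Strict Implicit.
Unset Printing Implicit Defensive.
Import Order.TTheory GRing.Theory Num.Theory.
Import numFieldNormedType.Exports.
Local Open Scope classical_set_scope.
Local Open Scope ring_scope.

Definition sumset (G : zmodType) (C W : set G) : set G :=
  [set c + w | c in C & w in W].

Definition additive_complement (G : zmodType) (C W : set G) : Prop :=
  sumset C W = setT.

(* `<` is proper inclusion of sets. *)
Definition minimal_additive_complement (G : zmodType) (C W : set G) : Prop :=
  additive_complement C W /\
  forall C' : set G, C' `<` C -> ~ additive_complement C' W.

Definition arises_as_mac (G : zmodType) (C : set G) : Prop :=
  exists W : set G, minimal_additive_complement C W.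

(* The convention here is that the natural numbers are {1, 2, 3, ...}. *)
Definition posnat : set nat := [set n | (0 < n)%N].

(* u lists A increasingly, A = {u 0 < u 1 < ...}; numbering from 0 instead of 1
   does not affect limits or upper limits. *)
Definition enumerates (u : nat -> nat) (A : set nat) : Prop :=
  {homo u : i j / (i < j)%N} /\ range u = A.

(* Extended-real valued, so that upper limits and limits may equal +oo. *)
Definition gaps (R : realType) (u : nat -> nat) : (\bar R)^nat :=
  fun i => ((u i.+1)%:R - (u i)%:R)%:E.

Definition in_int (A : set nat) : set int := [set n%:Z | n in A].

(* Main.v *)
(** (i) Build W as an increasing union of finite sets, together with, for each
    index k, a target n with n - c_k in W and n - c_j not in W for j <> k.
    Invariant: every integer not yet covered by C + W lies on one side of all
    the targets chosen so far.  Such an integer z can then be covered without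
    spoiling any target by adding z - c_i, where c_i is the left or the right
    end of a sufficiently large gap of C.  To create a target for c_k, cover a
    large interval [-B, B] and take for n the least uncovered integer beyond B:
    large gaps ensure that n exists, minimality preserves the invariant, and
    n - c_k is too large to affect the previous targets.

    (ii) If C is a minimal complement to W, two elements of C have distinct
    targets n and n'.  As C is bounded below, W is unbounded below, and for w
    in W near -oo both n - w and n' - w are positive and lie outside C.  So the
    complement of C contains arbitrarily large pairs at the fixed distance
    |n - n'|. *)
Require Import Defs.
From HB Require Import structures.
From mathcomp Require Import all_boot all_order all_algebra.
From mathcomp Require Import all_classical all_reals all_analysis.
From mathcomp Require Import zify.
Import Order.TTheory GRing.Theory Num.Theory.
Import numFieldNormedType.Exports.
Local Open Scope classical_set_scope.
Local Open Scope ring_scope.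

(** * Gap conditions as inequalities between naturals *)

Lemma limn_esup_gaps_large (R : realType) (c : nat -> nat) :
  limn_esup (gaps R c) = +oo%E ->
  forall L K : nat, exists2 i, (K <= i)%N & (c i + L <= c i.+1)%N.
Proof.
move=> h L K; apply: contrapT => no_gap.
suff: (limn_esup (gaps R c) <= L%:R%:E)%E by rewrite h leye_eq.
rewrite /limn_esup limf_esupE.
apply: (@le_trans _ _ (ereal_sup (gaps R c @` [set i | (K <= i)%N]))).
  by apply: ereal_inf_lbound; exists [set i | (K <= i)%N] => //; exists K.
apply: ge_ereal_sup => _ [i /= Ki <-].
rewrite /gaps lee_fin lerBlDr -natrD ler_nat leqNgt; apply/negP => lt_gap.
by apply: no_gap; exists i => //; lia.
Qed.

Lemma cvg_gaps_large (R : realType) (c : nat -> nat) :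
  gaps R c @ \oo --> +oo%E ->
  forall L : nat, exists K, forall i, (K <= i)%N -> (c i + L <= c i.+1)%N.
Proof.
move=> /cvgeyPge h L; have [K _ hK] := h L%:R; exists K => i Ki.
by have := hK i Ki; rewrite /gaps /= lee_fin lerBrDr -natrD ler_nat addnC.
Qed.

(** * Part (ii): targets and sparse complements *)

Lemma mac_target (G : zmodType) (C W : set G) (x : G) :
  minimal_additive_complement C W -> C x ->
  exists2 n, W (n - x) & forall y, C y -> W (n - y) -> y = x.
Proof.
move=> [covCW minC] Cx; apply: contrapT => no_target.
(* Without a target, [C] minus [x] would still cover everything: an [n] reached only through [x]
   would be a target. *)
apply: (minC (C `\ x)).
  by split=> [y [] //|/(_ x Cx)[] _]; apply.
rewrite /additive_complement -subTset => n _.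
have [y Cy [w Ww ywn]] : sumset C W n by rewrite covCW.
have [yx|yx] := pselect (y = x); last by exists y => //; exists w.
apply: contrapT => not_cov; apply: no_target; exists n.
  by rewrite -ywn yx addrC addKr.
move=> z Cz Wz; apply: contrapT => zx; apply: not_cov.
by exists z => //; exists (n - z) => //; rewrite addrC subrK.
Qed.

Lemma complement_unbounded (C W : set int) (m : int) :
  C `<=` [set x | m <= x] -> additive_complement C W ->
  forall B : int, exists2 w, W w & w < B.
Proof.
move=> Cm covCW B.
(* Elements of [C] are at least [m], so reaching [m + B - 1] takes a [w] below [B]. *)
have [x Cx [w Ww xw]] : sumset C W (m + B - 1) by rewrite covCW.
by exists w => //; have /= := Cm x Cx; lia.
Qed.

Lemma sparse_complement_not_mac (C : set nat) (cbar : nat -> nat) (a b : nat) :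
  C a -> C b -> a <> b -> enumerates cbar (posnat `\` C) ->
  (forall L : nat, exists K, forall i, (K <= i)%N ->
     (cbar i + L <= cbar i.+1)%N) ->
  ~ arises_as_mac (in_int C).
Proof.
move=> Ca Cb ab [cbar_mono cbar_range] large [W mac].
have cbar_leq := leq_mono cbar_mono.
(* Here [n - w] is positive and exceeds [x]; were it in [C], the target property would make it equal
   to [x]. *)
have key (x n : int) w : in_int C x ->
    (forall y, in_int C y -> W (n - y) -> y = x) ->
    W w -> w < n - x -> w < n -> exists i, (cbar i)%:Z = n - w.
  move=> Cx target Ww wnx wn.
  have [k nwk] : exists k : nat, n - w = k%:Z by exists `|n - w|%N; lia.
  suff [i _ ik] : range cbar k by exists i; rewrite nwk ik.
  rewrite cbar_range; split; first by rewrite /posnat /=; lia.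
  move=> Ck; have kx : k%:Z = x.
    by apply: target; [exists k | rewrite -nwk opprB addrC subrK].
  by lia.
have Ca' : in_int C a%:Z by exists a.
have Cb' : in_int C b%:Z by exists b.
have [n Wn n_target] := mac_target _ _ _ _ mac Ca'.
have [n' Wn' n'_target] := mac_target _ _ _ _ mac Cb'.
have nn' : n <> n'.
  move=> nE; have : a%:Z = b%:Z by apply: n'_target => //; rewrite -nE.
  by lia.
have [K hK] := large `|n - n'|.+1.
have C0 : in_int C `<=` [set x | 0 <= x] by move=> _ [k _ <-] /=; lia.
(* The bound pushes [n - w] and [n' - w] past [cbar K], where gaps exceed their distance. *)
have [w Ww wB] := complement_unbounded _ _ _ C0 mac.1
  (- (`|n| + `|n'| + a%:Z + b%:Z + (cbar K)%:Z + 1)).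
have [||i iE] := key a%:Z n w Ca' n_target Ww; [lia|lia|].
have [||j jE] := key b%:Z n' w Cb' n'_target Ww; [lia|lia|].
have Ki : (K <= i)%N by rewrite -cbar_leq; lia.
have Kj : (K <= j)%N by rewrite -cbar_leq; lia.
have gi := hK i Ki; have gj := hK j Kj.
case: (ltngtP i j) => [ij|ji|ij].
- by have : (cbar i.+1 <= cbar j)%N; [rewrite cbar_leq | lia].
- by have : (cbar j.+1 <= cbar i)%N; [rewrite cbar_leq | lia].
- by subst j; lia.
Qed.

(** * Part (i): finite stages and their union *)

Definition covered (c : nat -> nat) (W : seq int) (z : int) : Prop :=
  exists j, z - (c j)%:Z \in W.

(* [(i, n) \in N] records that n is the target reserved for [c i]. *)
Definition targets_kept (c : nat -> nat) (W : seq int) (N : seq (nat * int)) :=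
  (forall i n j, (i, n) \in N -> n - (c j)%:Z \in W -> j = i) /\
  (forall z, ~ covered c W z ->
     (forall p, p \in N -> z < p.2) \/ (forall p, p \in N -> p.2 < z)).

Lemma seq_int_bounded (s : seq int) :
  exists B : nat, forall x, x \in s -> `|x| <= B%:Z.
Proof.
elim: s => [|y s [B hB]]; first by exists 0%N.
exists (B + `|y|)%N => x; rewrite inE => /orP[/eqP ->|/hB]; lia.
Qed.

Lemma covered_sub (c : nat -> nat) (W W' : seq int) (z : int) :
  {subset W <= W'} -> covered c W z -> covered c W' z.
Proof. by move=> WW' [j /WW' Wj]; exists j. Qed.

Lemma cover_one (c : nat -> nat) (W : seq int) (N : seq (nat * int)) (z : int) :
  {homo c : i j / (i < j)%N} ->
  (forall L K : nat, exists2 i, (K <= i)%N & (c i + L <= c i.+1)%N) ->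
  targets_kept c W N ->
  exists W', [/\ targets_kept c W' N, {subset W <= W'} & covered c W' z].
Proof.
move=> c_mono large keptW; have [uniqN sepN] := keptW.
have c_leq := leq_mono c_mono.
have [zW|nzW] := pselect (covered c W z); first by exists W; split.
have [D hD] := seq_int_bounded [seq p.2 - z | p <- N].
have {}hD p : p \in N -> `|p.2 - z| <= D.
  by move=> pN; apply: hD; apply/mapP; exists p.
have [i _ gap] := large D.+1 0%N.
have no_between j : ~ (c i < c j < c i.+1)%N.
  have [ij|ji] := leqP j i.
    by have : (c j <= c i)%N; [rewrite c_leq | lia].
  by have : (c i.+1 <= c j)%N; [rewrite c_leq | lia].
have extend w k : w = z - (c k)%:Z ->
    (forall p j, p \in N -> p.2 - (c j)%:Z <> w) ->
    exists W', [/\ targets_kept c W' N, {subset W <= W'} & covered c W' z].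
  move=> wE fresh; have sub : {subset W <= w :: W}.
    by move=> x xW; rewrite inE xW orbT.
  exists (w :: W); split=> //; last by exists k; rewrite inE wE eqxx.
  split=> [m n j mnN|y ny].
    rewrite inE => /orP[/eqP nw|]; last exact: uniqN.
    by have := fresh _ j mnN.
  by apply: sepN => yW; apply: ny; apply: covered_sub yW.
(* If the targets lie right of [z], then [p.2 - w = c i + (p.2 - z)] falls strictly inside the gap
   after [c i]. If they lie left, the upper end [c i.+1] works symmetrically. *)
case: (sepN z nzW) => side.
- apply: (extend _ i erefl) => p j pN e.
  by apply: (no_between j); have := side p pN; have := hD p pN; lia.
- apply: (extend _ i.+1 erefl) => p j pN e.
  by apply: (no_between j); have := side p pN; have := hD p pN; lia.
Qed.

Lemma cover_seq (c : nat -> nat) (W : seq int) (N : seq (nat * int))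
    (s : seq int) :
  {homo c : i j / (i < j)%N} ->
  (forall L K : nat, exists2 i, (K <= i)%N & (c i + L <= c i.+1)%N) ->
  targets_kept c W N ->
  exists W', [/\ targets_kept c W' N, {subset W <= W'} &
                 forall z, z \in s -> covered c W' z].
Proof.
move=> c_mono large keptW; elim: s => [|y s [W1 [kept1 sub1 cov1]]].
  by exists W; split.
have [W2 [kept2 sub2 cov2]] := cover_one c W1 N y c_mono large kept1.
exists W2; split=> [//|x /sub1/sub2 //|z].
rewrite inE => /orP[/eqP -> //|/cov1]; exact: covered_sub.
Qed.

(** With [W] inside [[-D, D]], a point more than [D] away from both ends of a long gap is out of
    reach. *)
Lemma uncovered_large (c : nat -> nat) (W : seq int) (B : nat) :
  {homo c : i j / (i < j)%N} ->
  (forall L K : nat, exists2 i, (K <= i)%N & (c i + L <= c i.+1)%N) ->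
  exists n : nat, (B < n)%N /\ ~ covered c W n%:Z.
Proof.
move=> c_mono large; have c_leq := leq_mono c_mono.
have [D hD] := seq_int_bounded W.
have [i Bi gap] := large (2 * D + 2)%N B.
have ci : (i <= c i)%N.
  elim: (i) => // k IH; exact: leq_ltn_trans IH (c_mono _ _ (ltnSn k)).
exists (c i + D + 1)%N; split; first by lia.
move=> [j /hD]; have [ji|ij] := leqP j i.
  by have : (c j <= c i)%N; [rewrite c_leq | lia].
by have : (c i.+1 <= c j)%N; [rewrite c_leq | lia].
Qed.

(** The index [k] doubles as the radius of an interval to cover, so that running through all [k]
    exhausts the integers. *)
Lemma add_target (c : nat -> nat) (W : seq int) (N : seq (nat * int))
    (k : nat) :
  {homo c : i j / (i < j)%N} -> (forall i, (0 < c i)%N) ->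
  (forall L K : nat, exists2 i, (K <= i)%N & (c i + L <= c i.+1)%N) ->
  targets_kept c W N ->
  exists W' N', [/\ targets_kept c W' N', {subset W <= W'}, {subset N <= N'},
    exists n, (k, n) \in N' & forall z, `|z| <= k%:Z -> covered c W' z].
Proof.
move=> c_mono c_pos large keptW; have c_leq := leq_mono c_mono.
have [M hM] := seq_int_bounded [seq p.2 | p <- N].
have {}hM p : p \in N -> `|p.2| <= M.
  by move=> pN; apply: hM; apply/mapP; exists p.
(* [M] accounts for the old targets, [c k] makes [n - c k] exceed them once [n > B], and [k] is the
   required radius. *)
pose B := (M + c k + k)%N.
have [W1 [[uniq1 sep1] sub1 cov1]] := cover_seq c W N
  [seq i%:Z - B%:Z | i <- iota 0 (2 * B).+1] c_mono large keptW.
have {}cov1 (z : int) : `|z| <= B%:Z -> covered c W1 z.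
  move=> zB; apply: cov1; apply/mapP; exists `|(z + B%:Z)%R|%N; last by lia.
  by rewrite mem_iota; lia.
have exn : exists n, (B < n)%N && `[< ~ covered c W1 n%:Z >].
  have [n [Bn nn]] := uncovered_large c W1 B c_mono large.
  by exists n; rewrite Bn; apply/asboolP.
case: (ex_minnP exn) => n /andP[Bn /asboolP n_unc] n_min.
have sub2 : {subset W1 <= n%:Z - (c k)%:Z :: W1}.
  by move=> x xW; rewrite inE xW orbT.
exists (n%:Z - (c k)%:Z :: W1), ((k, n%:Z) :: N); split.
- split=> [i m j|z nz].
    rewrite !inE => /orP[/eqP[-> ->]|imN] /orP[/eqP e|mW].
    + have ckj : c j = c k by lia.
      by apply/eqP; rewrite eqn_leq -(c_leq j) -(c_leq k) ckj leqnn.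
    + by case: n_unc; exists j.
    + have cj := c_pos j; have /= mM := hM _ imN.
      by have : (c k <= B)%N; lia.
    + exact: uniq1 imN mW.
  (* Such a [z] lies below [-B] or above [n], while the old targets stay in [[-M, M]]. *)
  have nzW : ~ covered c W1 z by move=> zW; apply: nz; apply: covered_sub zW.
  have zn : z <> n%:Z by move=> zn; apply: nz; exists k; rewrite zn inE eqxx.
  have zB : ~ `|z| <= B%:Z by move/cov1.
  have z_min : ~ (B%:Z < z < n%:Z).
    move=> zBn; have := n_min `|z|%N; have -> : `|z|%N%:Z = z by lia.
    have -> : `[< ~ covered c W1 z >] by apply/asboolP.
    by rewrite andbT; lia.
  have MB : (M <= B)%N by lia.
  have [z0|z0] := ltP z 0; [left|right]; move=> p; rewrite inE.
    by move=> /orP[/eqP -> /=|/hM]; lia.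
  by move=> /orP[/eqP -> /=|/hM]; lia.
- by move=> x /sub1/sub2.
- by move=> x xN; rewrite inE xN orbT.
- by exists n%:Z; rewrite inE eqxx.
- by move=> z zk; apply: covered_sub sub2 _; apply: cov1; lia.
Qed.

Lemma large_gaps_mac (C : set nat) (c : nat -> nat) :
  enumerates c C -> C `<=` posnat ->
  (forall L K : nat, exists2 i, (K <= i)%N & (c i + L <= c i.+1)%N) ->
  arises_as_mac (in_int C).
Proof.
move=> [c_mono c_range] C_pos large.
have Cc i : C (c i) by rewrite -c_range; exists i.
have c_pos i : (0 < c i)%N := C_pos _ (Cc i).
pose state := (seq int * seq (nat * int))%type.
pose next (x : nat * state) (y : state) :=
  targets_kept c x.2.1 x.2.2 ->
  [/\ targets_kept c y.1 y.2, {subset x.2.1 <= y.1}, {subset x.2.2 <= y.2},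
    exists n, (x.1, n) \in y.2 & forall z, `|z| <= x.1%:Z -> covered c y.1 z].
have /choice[f fP] : forall x, exists y, next x y.
  move=> [k [W N]].
  (* The empty pair is a dummy value: [next] demands nothing when the invariant fails. *)
  have [kept|nkept] := pselect (targets_kept c W N); last by exists ([::], [::]).
  have [W' [N' h]] := add_target c W N k c_mono c_pos large kept.
  by exists (W', N').
pose st := fix st k :=
  if k is k'.+1 then f (k', st k') else (([::], [::]) : state).
have kept k : targets_kept c (st k).1 (st k).2.
  elim: k => [|k IH]; last by have [] := fP (k, st k) IH.
  by split=> // z _; left.
have stP k := fP (k, st k) (kept k).
have subW k m : (k <= m)%N -> {subset (st k).1 <= (st m).1}.
  elim: m => [|m IH]; first by rewrite leqn0 => /eqP ->.
  rewrite leq_eqVlt => /orP[/eqP -> //|/IH km] x /km.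
  by have [_ sub _ _ _] := stP m; apply: sub.
have subN k m : (k <= m)%N -> {subset (st k).2 <= (st m).2}.
  elim: m => [|m IH]; first by rewrite leqn0 => /eqP ->.
  rewrite leq_eqVlt => /orP[/eqP -> //|/IH km] x /km.
  by have [_ _ sub _ _] := stP m; apply: sub.
exists [set w | exists k, w \in (st k).1]; split.
  rewrite /additive_complement -subTset => z _.
  have [_ _ _ _ cov] := stP `|z|%N.
  have [|j zj] := cov z; first by rewrite /=; lia.
  exists (c j)%:Z; first by exists (c j).
  by exists (z - (c j)%:Z); [exists `|z|.+1 | rewrite addrC subrK].
move=> C' [C'C /existsNP[x0 /not_implyP[[x1 Cx1 <-] nC']]] covC'.
move: Cx1 nC'; rewrite -c_range => -[i _ <-] nC'.
have [_ _ _ [n nN] _] := stP i.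
have [x C'x [w [k wk] xw]] : sumset C' [set w | exists k, w \in (st k).1] n.
  by rewrite covC'.
have [x2 Cx2 xE] := C'C x C'x.
move: Cx2 xE; rewrite -c_range => -[j _ <-] xE.
(* At stage [maxn i.+1 k] both the target and [w] are present, so the invariant applies to them. *)
have {}nN := subN _ _ (leq_maxl i.+1 k) _ nN.
have {}wk := subW _ _ (leq_maxr i.+1 k) _ wk.
have ji : j = i.
  by apply: (kept _).1 nN _; rewrite xE -xw addrAC subrr add0r.
by apply: nC'; rewrite -ji xE.
Qed.

Theorem theorem1 (R : realType) (C : set nat) (c : nat -> nat)
    (C_pos : C `<=` posnat) (C_inf : infinite_set C) (c_enum : enumerates c C) :
  (limn_esup (gaps R c) = +oo%E -> arises_as_mac (in_int C))
  /\
  (infinite_set (posnat `\` C) ->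
   forall cbar : nat -> nat, enumerates cbar (posnat `\` C) ->
     gaps R cbar @ \oo --> +oo%E ->
     ~ arises_as_mac (in_int C)).
Proof.
split=> [/limn_esup_gaps_large|_ cbar cbar_enum /cvg_gaps_large large].
  exact: large_gaps_mac.
have Cc i : C (c i) by rewrite -c_enum.2; exists i.
apply: (sparse_complement_not_mac _ _ _ _ (Cc 0%N) (Cc 1%N) _ cbar_enum large).
by have := c_enum.1 0%N 1%N erefl; lia.
Qed.
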